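(* Let $T,U,V$ be unlabelled binary trees. For an element $w$ of the sylvester monoid $\mathrm{sylv}$ with $\mathrm{Sh}(\mathrm{P}(w)) = T$, let $N(w)$ be the number of pairs $(s,t) \in \mathrm{sylv}\times\mathrm{sylv}$ with $st = w$, $\mathrm{Sh}(\mathrm{P}(s)) = U$ and $\mathrm{Sh}(\mathrm{P}(t)) = V$. Then $N(w)$ depends only on $T$, $U$ and $V$, and not on the content of $w$: if $w,w' \in \mathrm{sylv}$ both satisfy $\mathrm{Sh}(\mathrm{P}(w)) = \mathrm{Sh}(\mathrm{P}(w')) = T$, then $N(w) = N(w')$.
   Context: $\mathcal{A} = \{1,2,3,\ldots\}$ with the usual order; $\mathcal{A}^*$ the free monoid over $\mathcal{A}$. A right strict binary search tree is a labelled rooted binary tree where each node's label is $\ge$ all labels in its left subtree and $<$ all labels in its right subtree. $\mathrm{rtree}(a_1\cdots a_k)$ is obtained from the empty tree by inserting $a_k,\ldots,a_1$ in turn, where inserting $a$ creates a node labelled $a$ if the tree is empty and otherwise recurses into the left subtree if $a \le$ root label and into the right subtree otherwise. The sylvester congruence is $u \equiv_{\mathrm{sylv}} v$ iff $\mathrm{rtree}(u) = \mathrm{rtree}(v)$; it is a congruence and the sylvester monoid is $\mathrm{sylv} = \mathcal{A}^*/{\equiv_{\mathrm{sylv}}}$. For $s \in \mathrm{sylv}$, $\mathrm{P}(s)$ denotes $\mathrm{rtree}(u)$ for any word $u$ representing $s$. $\mathrm{Sh}(\cdot)$ denotes the shape, i.e. the underlying unlabelled rooted binary tree. *)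

(* Defs.v *)
From HB Require Import structures.
From mathcomp Require Import all_boot finmap.
From mathcomp Require Import mathcomp_extra boolp classical_sets cardinality.

Set Implicit Arguments.
Unset Strict Implicit.
Unset Printing Implicit Defensive.

Local Open Scope quotient_scope.

Definition letter := {n : nat | 0 < n}.
HB.instance Definition _ := Countable.on letter.

Definition word := seq letter.

Definition le_letter (a b : letter) : bool := val a <= val b.

Inductive btree := SLeaf | SNode of btree & btree.

Inductive ltree := Leaf | Node of ltree & letter & ltree.

Fixpoint eq_ltree (s t : ltree) : bool :=
  match s, t with
  | Leaf, Leaf => true
  | Node l a r, Node l' a' r' => [&& eq_ltree l l', a == a' & eq_ltree r r']
  | _, _ => false
  end.

Lemma eq_ltreeP : Equality.axiom eq_ltree.
Proof.
elim=> [|l IHl a r IHr] [|l' a' r'] /=; try by constructor.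
by apply: (iffP and3P) => [[/IHl-> /eqP-> /IHr->] | [/IHl ? -> /IHr ?]].
Qed.

HB.instance Definition _ := hasDecEq.Build ltree eq_ltreeP.

Fixpoint Sh (t : ltree) : btree :=
  if t is Node l _ r then SNode (Sh l) (Sh r) else SLeaf.

Fixpoint insert (a : letter) (t : ltree) : ltree :=
  if t is Node l b r then
    if le_letter a b then Node (insert a l) b r else Node l b (insert a r)
  else Node Leaf a Leaf.

(* [foldr] inserts the last letter of the word first. *)
Definition rtree (u : word) : ltree := foldr insert Leaf u.

Definition sylv_eq (u v : word) : bool := rtree u == rtree v.

Lemma sylv_eq_refl : reflexive sylv_eq.
Proof. by move=> u; apply: eqxx. Qed.

Lemma sylv_eq_sym : symmetric sylv_eq.
Proof. by move=> u v; apply: eq_sym. Qed.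

Lemma sylv_eq_trans : transitive sylv_eq.
Proof. by move=> v u w /eqP uv /eqP vw; apply/eqP; rewrite uv. Qed.

Canonical sylv_equiv :=
  EquivRel sylv_eq sylv_eq_refl sylv_eq_sym sylv_eq_trans.

(* [tree_le a t] and [tree_gt a t] are the trees of the subwords of letters
   [<= a] and [> a] of any word [u] with [rtree u = t]. *)
Fixpoint tree_le (a : letter) (t : ltree) : ltree :=
  if t is Node l b r then
    if le_letter b a then Node l b (tree_le a r) else tree_le a l
  else Leaf.

Fixpoint tree_gt (a : letter) (t : ltree) : ltree :=
  if t is Node l b r then
    if le_letter b a then tree_gt a r else Node (tree_gt a l) b r
  else Leaf.

Lemma le_letter_trans : transitive le_letter.
Proof. by move=> b a c; apply: leq_trans. Qed.

Lemma le_letter_total : total le_letter.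
Proof. by move=> a b; apply: leq_total. Qed.

Lemma tree_le_insert a c t : tree_le a (insert c t) =
  if le_letter c a then insert c (tree_le a t) else tree_le a t.
Proof.
elim: t => [|l IHl b r IHr] /=; first by case: ifP.
case cb: (le_letter c b); case ba: (le_letter b a); rewrite /= ba ?IHl ?IHr //=.
- by rewrite (le_letter_trans cb ba) cb.
- by rewrite cb; case: ifP.
- rewrite ifF //; apply: contraFF ba; apply: le_letter_trans.
  by have := le_letter_total c b; rewrite cb.
Qed.

Lemma tree_gt_insert a c t : tree_gt a (insert c t) =
  if le_letter c a then tree_gt a t else insert c (tree_gt a t).
Proof.
elim: t => [|l IHl b r IHr] /=; first by case: ifP.
case cb: (le_letter c b); case ba: (le_letter b a); rewrite /= ba ?IHl ?IHr //=.
- by rewrite (le_letter_trans cb ba).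
- by rewrite cb; case: ifP.
- rewrite cb ifF //; apply: contraFF ba; apply: le_letter_trans.
  by have := le_letter_total c b; rewrite cb.
Qed.

Lemma rtree_le a u : rtree [seq c <- u | le_letter c a] = tree_le a (rtree u).
Proof.
by elim: u => //= c u; rewrite tree_le_insert => <-; case: le_letter.
Qed.

Lemma rtree_gt a u :
  rtree [seq c <- u | ~~ le_letter c a] = tree_gt a (rtree u).
Proof.
by elim: u => //= c u; rewrite tree_gt_insert => <-; case: le_letter.
Qed.

Lemma foldr_insert_Node u l a r : foldr insert (Node l a r) u =
  Node (foldr insert l [seq c <- u | le_letter c a]) a
       (foldr insert r [seq c <- u | ~~ le_letter c a]).
Proof. by elim: u => //= c u ->; rewrite /=; case: le_letter. Qed.

Lemma foldr_insert_congr t u u' :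
  rtree u = rtree u' -> foldr insert t u = foldr insert t u'.
Proof.
elim: t u u' => // l IHl a r IHr u u' uu'.
by rewrite !foldr_insert_Node (IHl _ [seq c <- u' | le_letter c a])
  ?(IHr _ [seq c <- u' | ~~ le_letter c a]) // ?rtree_le ?rtree_gt uu'.
Qed.

Lemma sylv_eq_cat u u' v v' :
  sylv_eq u u' -> sylv_eq v v' -> sylv_eq (u ++ v) (u' ++ v').
Proof.
move=> /eqP uu' /eqP vv'; apply/eqP; rewrite /rtree !foldr_cat.
by rewrite -!/(rtree _) vv'; apply: foldr_insert_congr.
Qed.

Definition sylv := {eq_quot sylv_equiv}.
HB.instance Definition _ := Choice.on sylv.
HB.instance Definition _ := EqQuotient.on sylv.

Definition sylv_of (u : word) : sylv := \pi u.

Lemma sylv_ofP u v : sylv_of u = sylv_of v <-> rtree u = rtree v.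
Proof.
by split=> [/eqmodP/eqP // | uv]; apply/eqmodP/eqP.
Qed.

Lemma sylv_of_repr s : sylv_of (repr s) = s.
Proof. exact: reprK. Qed.

Definition sylv_mul (s t : sylv) : sylv := sylv_of (repr s ++ repr t).

Lemma sylv_mul_of u v : sylv_mul (sylv_of u) (sylv_of v) = sylv_of (u ++ v).
Proof.
by apply/sylv_ofP/eqP; apply: sylv_eq_cat; apply/eqP/sylv_ofP/sylv_of_repr.
Qed.

Lemma sylv_mulA : associative sylv_mul.
Proof.
move=> s t r; rewrite -[s]sylv_of_repr -[t]sylv_of_repr -[r]sylv_of_repr.
by rewrite !sylv_mul_of catA.
Qed.

Lemma sylv_mul1 : left_id (sylv_of [::]) sylv_mul.
Proof. by move=> s; rewrite -[s]sylv_of_repr sylv_mul_of. Qed.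

Lemma sylv_mulr1 : right_id (sylv_of [::]) sylv_mul.
Proof. by move=> s; rewrite -[s]sylv_of_repr sylv_mul_of cats0. Qed.

HB.instance Definition _ := isMonoid.Build sylv sylv_mulA sylv_mul1 sylv_mulr1.

Lemma sylv_ofM u v : (sylv_of u * sylv_of v)%g = sylv_of (u ++ v).
Proof. exact: sylv_mul_of. Qed.

Definition P (s : sylv) : ltree := rtree (repr s).

Lemma P_of u : P (sylv_of u) = rtree u.
Proof. exact/sylv_ofP/sylv_of_repr. Qed.

Definition factorizations (U V : btree) (w : sylv) : set (sylv * sylv) :=
  [set st |
    [/\ (st.1 * st.2)%g = w, Sh (P st.1) = U & Sh (P st.2) = V]]%classic.

Fixpoint labels (t : ltree) : word :=
  if t is Node l a r then labels l ++ a :: labels r else [::].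

Lemma labels_rtree u : perm_eq (labels (rtree u)) u.
Proof.
elim: u => //= a u IHu; apply: (@perm_trans _ (a :: labels (rtree u))).
  elim: (rtree u) => //= l IHl b r IHr; case: ifP => _ /=.
    by rewrite -cat_cons perm_cat2r.
  rewrite -[a :: _]/([:: a] ++ _) perm_sym perm_catCA perm_cat2l perm_sym.
  by rewrite perm_sym (perm_catCA [:: a] [:: b]) perm_cat2l perm_sym.
by rewrite perm_cons.
Qed.

Lemma finite_factorizations U V w : finite_set (factorizations U V w).
Proof.
pose F (u : word) (i : nat) := (sylv_of (take i u), sylv_of (drop i u)).
pose I := iota 0 (size (repr w)).+1.
apply: (@sub_finite_set _ _
  [set` [seq F u i | u <- permutations (repr w), i <- I]]%classic); last first.
  exact: finite_seq.
move=> [s t] [/= stw _ _]; set u := repr s ++ repr t.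
have uw : perm_eq u (repr w).
  rewrite perm_sym; apply: perm_trans (labels_rtree _).
  rewrite perm_sym (_ : rtree u = rtree (repr w)) ?labels_rtree //.
  by apply/sylv_ofP; rewrite -sylv_ofM !sylv_of_repr.
apply/(@allpairsPdep _ (fun=> nat) _ F _ (fun=> I)).
exists u, (size (repr s)); split.
- by rewrite mem_permutations.
- by rewrite /I -(perm_size uw) mem_iota leq0n add0n ltnS size_cat leq_addr.
- by rewrite /F take_size_cat // drop_size_cat // !sylv_of_repr.
Qed.

(* [fset_set] is empty on infinite sets; [finite_factorizations] rules this
   case out. *)
Definition num_factorizations (U V : btree) (w : sylv) : nat :=
  #|` fset_set (factorizations U V w)|%fset.

(* Main.v *)
Require Import Defs.
From mathcomp Require Import all_boot finmap.
From mathcomp Require Import mathcomp_extra boolp classical_sets cardinality.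

(** On search trees the sylvester product reads [s * Node l a r =
    Node (s_{<= a} * l) a (s_{> a} * r)].  So a factorization of [Node L a R]
    with nontrivial right factor amounts to factorizations [(s1, l)] of [L] and
    [(s2, r)] of [R] together with a search tree [s] such that
    [s_{<= a} = s1] and [s_{> a} = s2].  These trees [s] are exactly the
    shuffles of the right spine of [s1] with the left spine of [s2], all of
    which are search trees; hence the list of the shapes of all factorizations
    is computed from the shape of the product alone. *)

Set Implicit Arguments.
Unset Strict Implicit.
Unset Printing Implicit Defensive.

(** * Preliminaries on lists and on the order of letters *)

Lemma uniq_flatten_map (A B : eqType) (f : A -> seq B) (s : seq A) :
  uniq s -> {in s, forall x, uniq (f x)} ->
  {in s &, forall x y, forall z, z \in f x -> z \in f y -> x = y} ->
  uniq (flatten (map f s)).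
Proof.
elim: s => //= x s IHs /andP[xs us] uf inj; rewrite cat_uniq uf ?mem_head //=.
rewrite IHs ?andbT //.
- apply/hasPn => z /flattenP[_ /mapP[y ys ->] zy]; apply/negP => zx.
  move: xs; rewrite (inj x y _ _ z zx zy) ?mem_head ?in_cons ?ys ?orbT //.
- by move=> y ys; apply: uf; rewrite in_cons ys orbT.
- by move=> y y' ys ys'; apply: inj; rewrite in_cons ?ys ?ys' orbT.
Qed.

Lemma gt_letterW a b : ~~ le_letter a b -> le_letter b a.
Proof. by have := le_letter_total a b; case: (le_letter a b). Qed.

Lemma gt_letter_trans a b c :
  le_letter a b -> ~~ le_letter c b -> ~~ le_letter c a.
Proof. by move=> ab; apply: contra => ca; apply: le_letter_trans ab. Qed.

(** * Search trees, canonical words and the product on trees *)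

Definition all_le a t := all (fun c => le_letter c a) (labels t).
Definition all_gt a t := all (fun c => ~~ le_letter c a) (labels t).

Fixpoint bst (t : ltree) : bool :=
  if t is Node l a r then [&& all_le a l, all_gt a r, bst l & bst r] else true.

Lemma bst_Node l a r :
  bst (Node l a r) = [&& all_le a l, all_gt a r, bst l & bst r].
Proof. by []. Qed.

(** The root is read last, hence inserted first by [rtree]; this makes [postorder] a section of
    [rtree] on search trees. *)
Fixpoint postorder (t : ltree) : word :=
  if t is Node l a r then postorder l ++ postorder r ++ [:: a] else [::].

Fixpoint tree_mul (s t : ltree) : ltree :=
  if t is Node l a r then
    Node (tree_mul (tree_le a s) l) a (tree_mul (tree_gt a s) r)
  else s.

Lemma all_labels_Node p l a r :
  all p (labels (Node l a r)) = [&& all p (labels l), p a & all p (labels r)].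
Proof. by rewrite /= all_cat. Qed.

Lemma all_labels_insert p a t :
  all p (labels (insert a t)) = p a && all p (labels t).
Proof.
elim: t => //= l IHl b r IHr.
case: ifP => _; rewrite all_labels_Node ?IHl ?IHr all_cat /= -?andbA //.
by rewrite [in RHS]andbCA; congr andb; rewrite [RHS]andbCA.
Qed.

Lemma all_labels_split p a t :
  all p (labels (tree_le a t)) && all p (labels (tree_gt a t)) =
  all p (labels t).
Proof.
elim: t => //= l IHl b r IHr; rewrite all_cat /=.
by case: ifP => _; rewrite all_labels_Node -?IHr -?IHl -!andbA.
Qed.

(** Through this lemma a bound on the labels of a product passes to both factors, and back. *)
Lemma all_labels_mul p s t :
  all p (labels (tree_mul s t)) = all p (labels s) && all p (labels t).
Proof.
elim: t s => [|l IHl a r IHr] s; first by rewrite andbT.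
rewrite [tree_mul _ _]/= !all_labels_Node IHl IHr -(all_labels_split p a s).
by rewrite -!andbA; congr andb; rewrite !andbA; congr andb; rewrite andbC andbA.
Qed.

Lemma bst_insert a t : bst t -> bst (insert a t).
Proof.
elim: t => //= l IHl b r IHr /and4P[lb rb bl br].
case: ifP => ab /=; rewrite /all_le /all_gt all_labels_insert ?ab.
- by apply/and4P; split=> //; apply: IHl.
- by apply/and4P; split=> //; apply: IHr.
Qed.

Lemma bst_rtree u : bst (rtree u).
Proof. by elim: u => //= a u; apply: bst_insert. Qed.

Lemma all_postorder p t : all p (postorder t) = all p (labels t).
Proof.
elim: t => //= l IHl a r IHr; rewrite !all_cat /= IHl IHr andbT.
by congr andb; rewrite andbC.
Qed.

Lemma rtree_postorder t : bst t -> rtree (postorder t) = t.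
Proof.
elim: t => //= l IHl a r IHr /and4P[la ra bl br].
rewrite /rtree catA foldr_cat /= foldr_insert_Node !filter_cat.
rewrite -!/(rtree _).
have /all_filterP-> : all (fun c => le_letter c a) (postorder l).
  by rewrite all_postorder.
have /all_filterP-> : all (fun c => ~~ le_letter c a) (postorder r).
  by rewrite all_postorder.
rewrite [filter _ (postorder r)](_ : _ = [::]); last first.
  apply/eqP; rewrite -(negbK (_ == _)) -has_filter -all_predC all_postorder.
  exact: ra.
rewrite [filter _ (postorder l)](_ : _ = [::]) ?cats0 ?IHl ?IHr //.
apply/eqP; rewrite -(negbK (_ == _)) -has_filter -all_predC all_postorder.
by apply: sub_all la => c /= ->.
Qed.

(** The root [a] of [t] stays in place, and each letter of [u] goes left or right of it according to
    its comparison with [a]; [rtree] turns these two subwords into [tree_le a] and [tree_gt a]. *)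
Lemma foldr_insertE u t : foldr insert t u = tree_mul (rtree u) t.
Proof.
elim: t u => // l IHl a r IHr u.
by rewrite foldr_insert_Node IHl IHr rtree_le rtree_gt.
Qed.

(** * Elements of the sylvester monoid as search trees *)

Lemma P_mul s t : P (s * t)%g = tree_mul (P s) (P t).
Proof.
rewrite -{1}[s]sylv_of_repr -{1}[t]sylv_of_repr sylv_ofM P_of.
by rewrite /rtree foldr_cat foldr_insertE.
Qed.

Definition sylv_of_tree (t : ltree) : sylv := sylv_of (postorder t).

Lemma P_of_tree t : bst t -> P (sylv_of_tree t) = t.
Proof. by move=> bt; rewrite P_of rtree_postorder. Qed.

Lemma P_inj : injective P.
Proof.
by move=> s t st; rewrite -[s]sylv_of_repr -[t]sylv_of_repr; apply/sylv_ofP.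
Qed.

Lemma bst_P s : bst (P s).
Proof. exact: bst_rtree. Qed.

Lemma PK s : sylv_of_tree (P s) = s.
Proof. by apply: P_inj; rewrite P_of_tree ?bst_P. Qed.

(** * Splitting a tree at a letter *)

Lemma tree_le_id a t : all_le a t -> tree_le a t = t.
Proof.
elim: t => //= l _ b r IHr; rewrite /all_le all_labels_Node.
by move=> /and3P[_ -> /IHr->].
Qed.

Lemma tree_gt_id a t : all_gt a t -> tree_gt a t = t.
Proof.
elim: t => //= l IHl b r _; rewrite /all_gt all_labels_Node.
by move=> /and3P[/IHl-> /negPf-> _].
Qed.

Lemma tree_gt_Leaf a t : all_le a t -> tree_gt a t = Leaf.
Proof.
elim: t => //= l _ b r IHr; rewrite /all_le all_labels_Node.
by move=> /and3P[_ -> /IHr->].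
Qed.

Lemma tree_le_Leaf a t : all_gt a t -> tree_le a t = Leaf.
Proof.
elim: t => //= l IHl b r _; rewrite /all_gt all_labels_Node.
by move=> /and3P[/IHl-> /negPf-> _].
Qed.

Lemma all_tree_le p a t : all p (labels t) -> all p (labels (tree_le a t)).
Proof. by rewrite -(all_labels_split p a) => /andP[]. Qed.

Lemma all_tree_gt p a t : all p (labels t) -> all p (labels (tree_gt a t)).
Proof. by rewrite -(all_labels_split p a) => /andP[]. Qed.

Lemma bst_tree_le a t : bst t -> bst (tree_le a t).
Proof.
elim: t => //= l IHl b r IHr /and4P[lb rb bl br].
by case: ifP => _ /=; rewrite ?IHl // lb bl IHr // /all_gt all_tree_le.
Qed.

Lemma bst_tree_gt a t : bst t -> bst (tree_gt a t).
Proof.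
elim: t => //= l IHl b r IHr /and4P[lb rb bl br].
by case: ifP => _ /=; rewrite ?IHr // rb br IHl // /all_le all_tree_gt.
Qed.

(** * Shuffles of a right spine with a left spine *)

Fixpoint merges (s : ltree) : ltree -> seq ltree :=
  if s is Node l b r then
    fix merges_s t := if t is Node l' c r' then
      [seq Node l b x | x <- merges r t] ++ [seq Node x c r' | x <- merges_s l']
    else [:: s]
  else fun t => [:: t].

(** Since [merges] never compares labels, the same recursion works on shapes. The inner [fix] allows
    either argument to decrease. *)
Fixpoint shape_merges (s : btree) : btree -> seq btree :=
  if s is SNode l r then
    fix merges_s t := if t is SNode l' r' then
      [seq SNode l x | x <- shape_merges r t] ++
      [seq SNode x r' | x <- merges_s l']
    else [:: s]
  else fun t => [:: t].

Lemma merges_Node l b r l' c r' :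
  merges (Node l b r) (Node l' c r') =
  [seq Node l b x | x <- merges r (Node l' c r')] ++
  [seq Node x c r' | x <- merges (Node l b r) l'].
Proof. by []. Qed.

Lemma mergesL s : merges s Leaf = [:: s].
Proof. by case: s. Qed.

Lemma Sh_merges s t : map Sh (merges s t) = shape_merges (Sh s) (Sh t).
Proof.
elim: s t => // l _ b r IHr; elim=> // l' IHl' c r' _.
rewrite merges_Node map_cat -!map_comp.
have -> : shape_merges (Sh (Node l b r)) (Sh (Node l' c r')) =
  [seq SNode (Sh l) x | x <- shape_merges (Sh r) (Sh (Node l' c r'))] ++
  [seq SNode x (Sh r') | x <- shape_merges (Sh (Node l b r)) (Sh l')] by [].
by rewrite -IHr -IHl' -!map_comp.
Qed.

(** The root of [t] is also the root of the part on its side of [a], so one step of the shuffle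
    peels it off. *)
Lemma mem_merges_split a t :
  bst t -> t \in merges (tree_le a t) (tree_gt a t).
Proof.
elim: t => //= l IHl b r IHr /and4P[lb rb bl br]; case: ifP => ba.
- have := IHr br; case: (tree_gt a r) => [|l' c r'].
    by rewrite !mergesL !inE => /eqP<-.
  by move=> rm; rewrite merges_Node mem_cat map_f.
- have := IHl bl; case: (tree_le a l) => [|l' c r'].
    by rewrite !inE => /eqP<-.
  by move=> lm; rewrite merges_Node mem_cat orbC map_f.
Qed.

(** All labels of [s] are [<= a] and all labels of [t] are [> a], so either root may be placed above
    the rest of the other tree. The last conclusion serves the induction: it carries label bounds to
    the subtree below the new root. *)
Lemma mergesP a s t x : all_le a s -> all_gt a t -> bst s -> bst t ->
  x \in merges s t -> [/\ bst x, tree_le a x = s, tree_gt a x = t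
    & forall p, all p (labels x) = all p (labels s) && all p (labels t)].
Proof.
elim: s t x => [|l _ b r IHr] t x.
  by move=> _ ta _ bt; rewrite inE => /eqP->; rewrite tree_le_Leaf ?tree_gt_id.
elim: t x => [|l' IHl' c r' _] x sa ta bs bt.
  rewrite inE => /eqP->; rewrite tree_le_id ?tree_gt_Leaf //.
  by split=> // p; rewrite andbT.
have [] := (sa, ta); rewrite /all_le /all_gt !all_labels_Node.
move=> /and3P[la ba ra] /and3P[l'a ca r'a].
rewrite merges_Node mem_cat => /orP[] /mapP[y ym ->].
- have := bs; rewrite bst_Node => /and4P[lb rb bl br].
  have [by_ yl yg yp] := IHr _ _ ra ta br bt ym.
  split=> /=; rewrite ?ba ?yl ?yg //.
    rewrite lb bl by_ !andbT andTb /all_gt yp; apply/andP; split=> //.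
    by apply: sub_all ta => d; apply: gt_letter_trans.
  by move=> p; rewrite !all_cat /= yp !all_labels_Node -!andbA.
- have := bt; rewrite bst_Node => /and4P[l'c r'c bl' br'].
  have [by_ yl yg yp] := IHl' _ sa l'a bs bl' ym.
  split=> /=; rewrite ?(negPf ca) ?yl ?yg //.
    rewrite r'c br' by_ !andbT /all_le yp; apply/andP; split=> //.
    apply: sub_all sa => d da; apply: le_letter_trans da _.
    exact: gt_letterW.
  by move=> p; rewrite !all_cat /= yp !all_labels_Node -!andbA.
Qed.

(** The two halves of the list cannot meet: the root label is [<= a] in the first and [> a] in the
    second. *)
Lemma uniq_merges a s t : all_le a s -> all_gt a t -> uniq (merges s t).
Proof.
elim: s t => // l _ b r IHr; elim=> // l' IHl' c r' _ sa ta.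
have [] := (sa, ta); rewrite /all_le /all_gt !all_labels_Node.
move=> /and3P[la ba ra] /and3P[l'a ca r'a].
rewrite merges_Node cat_uniq !map_inj_uniq ?IHr ?IHl' //=; try by move=> ? ? [].
rewrite andbT; apply/hasPn => _ /mapP[x _ ->]; apply/mapP => -[y _ [_ cb _]].
by rewrite cb ba in ca.
Qed.

(** * Factorizations of a search tree *)

Fixpoint factors (w : ltree) : seq (ltree * ltree) :=
  if w is Node l a r then
    (w, Leaf) :: flatten
      [seq [seq (s, Node z.1.2 a z.2.2) | s <- merges z.1.1 z.2.1]
      | z <- [seq (x, y) | x <- factors l, y <- factors r]]
  else [:: (Leaf, Leaf)].

(** The head is the factorization with trivial right factor; in all others the root of the right
    factor is the root of the product, so only the subtrees and the shuffle remain to be chosen. *)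
Fixpoint shape_factors (w : btree) : seq (btree * btree) :=
  if w is SNode l r then
    (w, SLeaf) :: flatten
      [seq [seq (s, SNode z.1.2 z.2.2) | s <- shape_merges z.1.1 z.2.1]
      | z <- [seq (x, y) | x <- shape_factors l, y <- shape_factors r]]
  else [:: (SLeaf, SLeaf)].

Definition Sh2 (st : ltree * ltree) : btree * btree := (Sh st.1, Sh st.2).

Lemma Sh_factors w : map Sh2 (factors w) = shape_factors (Sh w).
Proof.
elim: w => //= l IHl a r IHr; congr cons; rewrite -IHl -IHr.
rewrite map_flatten -map_comp allpairs_mapl allpairs_mapr.
rewrite -(map_allpairs (fun z => (Sh2 z.1, Sh2 z.2)) (fun x y => (x, y))).
rewrite -map_comp.
congr flatten; apply: eq_map => -[[s1 l'] [s2 r']] /=.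
by rewrite -Sh_merges -!map_comp.
Qed.

Lemma mem_factors w s t : bst w ->
  ((s, t) \in factors w) = [&& bst s, bst t & tree_mul s t == w].
Proof.
elim: w s t => [|L IHL a R IHR] s t.
  by move=> _; rewrite inE; case: t => [|l b r];
    case: s => //= *; rewrite ?andbF.
move=> bW; have := bW; rewrite bst_Node => /and4P[La Ra bL bR].
apply/idP/and3P => [|[bs bt /eqP]].
  rewrite inE => /orP[/eqP[-> ->] //|].
  case/flattenP=> _ /mapP[z + ->].
  case/allpairsP=> -[[s1 l] [s2 r]] /= [ml mr ->].
  case/mapP=> _ /[swap] -[<- ->] /= ms.
  move: ml mr; rewrite IHL // IHR //.
  move=> /and3P[b1 bl /eqP mL] /and3P[b2 br /eqP mR].
  (* The bounds on [L] and [R] give those on their factors, as [mergesP] requires. *)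
  move: La Ra; rewrite /all_le /all_gt -mL -mR !all_labels_mul.
  move=> /andP[s1a la] /andP[s2a ra].
  have [bs -> -> _] := mergesP s1a s2a b1 b2 ms.
  by rewrite mL mR eqxx /all_le /all_gt la ra bl.
(* A leaf [t] gives the head of the list; otherwise the roots of [t] and of the product agree, so
   [b] is [a]. *)
case: t bt => [_ /= ->|l b r /= /and4P[lb rb bl br] [mL ba mR]].
  by rewrite mem_head.
rewrite {b}ba in mL mR lb rb *.
rewrite inE; apply/orP; right; apply/flattenP.
exists [seq (x, Node l a r) | x <- merges (tree_le a s) (tree_gt a s)].
  apply/mapP; exists ((tree_le a s, l), (tree_gt a s, r)) => //.
  apply/allpairsP; exists ((tree_le a s, l), (tree_gt a s, r)); split=> //=.
    by rewrite IHL // bst_tree_le // bl mL eqxx.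
  by rewrite IHR // bst_tree_gt // br mR eqxx.
by apply/mapP; exists s => //; apply: mem_merges_split.
Qed.

Lemma uniq_factors w : bst w -> uniq (factors w).
Proof.
elim: w => // L IHL a R IHR /= /and4P[La Ra bL bR].
have split_mem z : z \in [seq (x, y) | x <- factors L, y <- factors R] ->
    [/\ all_le a z.1.1, all_gt a z.2.1, bst z.1.1 & bst z.2.1].
  case/allpairsP=> -[[s1 l] [s2 r]] /= [ml mr -> /=].
  move: ml mr; rewrite !mem_factors //.
  move=> /and3P[b1 bl /eqP mL] /and3P[b2 br /eqP mR].
  move: La Ra; rewrite /all_le /all_gt -mL -mR !all_labels_mul.
  by move=> /andP[-> _] /andP[-> _].
apply/andP; split.
  (* The head has a leaf as right factor, all other entries a node. *)
  by apply/flattenP => -[_ /mapP[z _ ->] /mapP[]].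
apply: uniq_flatten_map.
- by apply: allpairs_uniq; rewrite ?IHL ?IHR // => -[? ?] [? ?] _ _ /= [-> ->].
- move=> z /split_mem[z1 z2 _ _]; rewrite map_inj_uniq ?(uniq_merges z1 z2) //.
  by move=> ? ? [].
(* Splitting [s] at [a] recovers [s1] and [s2], so a pair determines the block it comes from. *)
- move=> [[s1 l] [s2 r]] [[s1' l'] [s2' r']] /split_mem /= [a1 a2 b1 b2].
  move=> /split_mem /= [a1' a2' b1' b2'] x.
  move=> /mapP[s ms -> {x}] /mapP[s' ms' [ss -> ->]].
  rewrite -ss in ms'.
  have [_ <- <- _] := mergesP a1 a2 b1 b2 ms.
  by have [_ <- <- _] := mergesP a1' a2' b1' b2' ms'.
Qed.

(** * Counting factorizations by shape *)

Lemma factorizationsE U V w : factorizations U V w =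
  [set` [seq (sylv_of_tree x.1, sylv_of_tree x.2)
        | x <- factors (P w) & `[< Sh2 x = (U, V) >]]]%classic.
Proof.
apply/seteqP; split=> [[s t] [/= stw sU tV]|[s t] /=].
  apply/mapP; exists (P s, P t); last by rewrite /= !PK.
  rewrite mem_filter mem_factors ?bst_P //= -P_mul stw eqxx andbT.
  by apply/asboolP; rewrite /Sh2 /= sU tV.
case/mapP=> -[x y]; rewrite mem_filter mem_factors ?bst_P //=.
move=> /andP[/asboolP[xU yV] /and3P[bx by_ /eqP xyw]] [-> ->].
split; rewrite /= ?P_of_tree //.
by apply: P_inj; rewrite P_mul !P_of_tree.
Qed.

Lemma num_factorizationsE U V w : num_factorizations U V w =
  count (fun x => `[< x = (U, V) >]) (shape_factors (Sh (P w))).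
Proof.
rewrite /num_factorizations factorizationsE -Sh_factors count_map.
set s := map _ _.
(* Without repetitions, the size of the list is the cardinality of the set; [sylv_of_tree] is
   injective on search trees because [P] inverts it there. *)
have us : uniq s.
  rewrite map_inj_in_uniq ?filter_uniq ?uniq_factors ?bst_P //.
  move=> [x y] [x' y']; rewrite !mem_filter !mem_factors ?bst_P //=.
  move=> /andP[_ /and3P[bx by_ _]] /andP[_ /and3P[bx' by_' _]] [xx yy].
  by rewrite -(P_of_tree bx) -(P_of_tree by_) xx yy !P_of_tree.
have -> : [set` s]%classic = [set` [fset x in s]%fset]%classic.
  by apply/seteqP; split=> x /=; rewrite inE.
by rewrite set_fsetK card_fseq undup_id // size_map size_filter.
Qed.

Theorem theorem3 (T U V : btree) (w w' : sylv) :
  Sh (P w) = T -> Sh (P w') = T -> num_factorizations U V w =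
    num_factorizations U V w'.
Proof. by move=> wT w'T; rewrite !num_factorizationsE wT w'T. Qed.
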